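(* Let $a_1 > a_0$ be two elements of $\mathbb{I}$. Assume that 1. the set $\Phi(a_1,a_0) := \{ \phi : \mathbb{B}(a_0) \to \mathbb{B}(a_1) \mid \mathbb{B}_\phi(a_1,a_0) \neq \emptyset \}$ is not empty; 2. for every $b_1 \in \mathbb{B}(a_1)$ there exist at least one $\phi \in \Phi(a_1,a_0)$ and one $b_0 \in \mathbb{B}_\phi(a_1,a_0)$ such that $b_1 = \phi(b_0)$. Then there exists a set $K$ of functions $\mathbb{X} \to \mathbb{R}$ such that $$\Lambda^-(a_1) = \Lambda^-(a_0) + K$$ (Minkowski sum).
   Context: $\mathbb{X}$ is a set (of values of the uncertainty), $\mathbb{I} \subset \mathbb{R}$ is an interval (set of initial decisions $a$), $\mathbb{B}$ is a fixed set and, for each $a \in \mathbb{I}$, $\mathbb{B}(a) \subset \mathbb{B}$ is the set of second decisions available after initial decision $a$. The utility function is $U : \mathbb{I} \times \mathbb{B} \times \mathbb{X} \to \mathbb{R}$, $(a,b,x) \mapsto U(a,b,x)$. For $a \in \mathbb{I}$, $$\Lambda^-(a) := \{ f : \mathbb{X} \to \mathbb{R} \mid \text{there exists } b \in \mathbb{B}(a) \text{ such that } f(x) \le U(a,b,x) \text{ for all } x \in \mathbb{X} \}.$$ For a mapping $\phi : \mathbb{B}(a_0) \to \mathbb{B}(a_1)$ and $x \in \mathbb{X}$, define the (possibly empty) set of minimizers $$\mathbb{B}_\phi(a_1,a_0,x) := \mathop{\mathrm{arg\,min}}_{b \in \mathbb{B}(a_0)} \big( U(a_1,\phi(b),x)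 - U(a_0,b,x) \big),$$ and $$\mathbb{B}_\phi(a_1,a_0) := \bigcap_{x \in \mathbb{X}} \mathbb{B}_\phi(a_1,a_0,x).$$ The Minkowski sum of two subsets $\Lambda_1,\Lambda_2$ of a vector space is $\Lambda_1 + \Lambda_2 = \{ x_1 + x_2 : x_1 \in \Lambda_1,\ x_2 \in \Lambda_2 \}$. *)

(* Defs.v *)
From mathcomp Require Import all_boot all_order all_algebra.
From mathcomp Require Import all_classical all_reals all_analysis.
Set Implicit Arguments.
Unset Strict Implicit.
Unset Printing Implicit Defensive.
Import Order.TTheory GRing.Theory Num.Theory.
Import numFieldNormedType.Exports.
Local Open Scope classical_set_scope.
Local Open Scope ring_scope.

Definition minkowski_sum (V : zmodType) (A B : set V) : set V :=
  [set x + y | x in A & y in B].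

Definition argmin (T : Type) (R : realType) (f : T -> R) : set T :=
  [set t | forall t', f t <= f t'].

(* [II] is the interval of initial decisions, [BB] the ambient set of second
   decisions, [B a] the second decisions available after [a], [X] the set of
   uncertainty values.  A subset used as a type denotes the associated subtype,
   so that [B] and [U] are defined for [a] in [II] only, and a map
   [phi : B a0 -> B a1] is defined on [B a0] only. *)

Definition Lambda_minus (R : realType) (II : set R) (BB X : Type)
    (B : II -> set BB) (U : II -> BB -> X -> R) (a : II) : set (X -> R) :=
  [set f | exists2 b, B a b & forall x, f x <= U a b x].

Definition Bphi_at (R : realType) (II : set R) (BB X : Type)
    (B : II -> set BB) (U : II -> BB -> X -> R) (a1 a0 : II)
    (phi : B a0 -> B a1) (x : X) : set (B a0) :=
  argmin (fun b : B a0 => U a1 (val (phi b)) x - U a0 (val b) x).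

(* For empty [X] the intersection is the whole of [B a0]. *)
Definition Bphi (R : realType) (II : set R) (BB X : Type)
    (B : II -> set BB) (U : II -> BB -> X -> R) (a1 a0 : II)
    (phi : B a0 -> B a1) : set (B a0) :=
  \bigcap_(x in [set: X]) Bphi_at U phi x.

Definition Phi (R : realType) (II : set R) (BB X : Type)
    (B : II -> set BB) (U : II -> BB -> X -> R) (a1 a0 : II) :
    set (B a0 -> B a1) :=
  [set phi | Bphi U phi !=set0].
Arguments Phi {R II BB X} B U a1 a0.

(* Main.v *)
Require Import Defs.
From mathcomp Require Import all_boot all_order all_algebra.
From mathcomp Require Import all_classical all_reals all_analysis.
Import Order.TTheory GRing.Theory Num.Theory.
Import numFieldNormedType.Exports.
Local Open Scope classical_set_scope.
Local Open Scope ring_scope.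

(* The largest candidate for K is the set of all g with
   Lambda^-(a0) + g included in Lambda^-(a1).  It contains f - U(a0,b0,.) as soon
   as f <= U(a1,phi(b0),.) with b0 in B_phi(a1,a0): by minimality of b0, for
   every b in B(a0),
   U(a0,b,.) + f - U(a0,b0,.) <= U(a0,b,.) + U(a1,phi(b),.) - U(a0,b,.). *)
Theorem proposition4 (R : realType) (II : set R) (hII : is_interval II)
    (BB X : Type) (B : II -> set BB) (U : II -> BB -> X -> R)
    (a0 a1 : II) (ha : val a0 < val a1)
    (hPhi : Phi B U a1 a0 !=set0)
    (hB : forall b1 : B a1, exists2 phi : B a0 -> B a1, Phi B U a1 a0 phi &
            exists2 b0 : B a0, Bphi U phi b0 & b1 = phi b0) :
  exists K : set (X -> R),
    Lambda_minus B U a1 = minkowski_sum (Lambda_minus B U a0) K.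
Proof.
exists [set g | forall f, Lambda_minus B U a0 f -> Lambda_minus B U a1 (f + g)].
(* The right-to-left inclusion is the very condition defining [K]. *)
apply/seteqP; split => [f [b1 Bb1 fU]|_ [f Lf [g Kg <-]]]; last exact: Kg.
have [phi _ [b0 b0_min b1E]] := hB (SigSub (mem_set Bb1)).
have {}b1E : b1 = val (phi b0) by rewrite -b1E.
(* This summand depends on [f] alone, and not on [x], since [b0] is a minimizer for all [x] at
   once. *)
exists (U a0 (val b0)); first by exists (val b0) => //; exact: set_valP.
exists (f - U a0 (val b0)); last by rewrite addrC subrK.
move=> h [b Bb hU]; pose b' : B a0 := SigSub (mem_set Bb).
(* The dominating decision follows [h] through [b], while [phi] and [b0] stay those obtained from
   [f]. *)
exists (val (phi b')); first exact: set_valP.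
move=> x; have := b0_min x I b'; have := fU x; have := hU x.
rewrite /= -b1E => hx fx minx.
(* Splitting off [U a0 b x] lets [hx] bound [h x]; the remainder is the quantity minimized at
   [b0]. *)
rewrite -[leRHS](subrKC (U a0 b x)); apply: lerD hx _.
by apply: le_trans minx; rewrite lerD2r.
Qed.
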